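(* Let $a,b\ge0$ be given integers. Then there are polynomials $A(m,n,d)$ and $B(m,n,d)$ in $m$ and $n$ of total degree at most $2a+b$, with coefficients rational functions of $d$, such that $G^-_{d,m,a,b}(n)=A(m,n,d)M_d(n)+B(m,n,d)M_d(n+1)$.
   Context: For integers $d\ge1$, $n\ge0$ let $\mathcal{A}_{d,n}=\{(i,j):1\le i\le d,\ 1\le j\le n\}$. A subset $I\subseteq\mathcal{A}_{d,n}$ is nice if (1) $(i+1,j)\in I$ with $i\ge1$ implies $(i,j)\in I$, and (2) $(1,j)\in I$ with $1\le j\le n-1$ implies $(1,j+1)\notin I$. $\mathcal{B}^-_{d,n}$ is the set of nice subsets $I$ of $\mathcal{A}_{d,n}$ with $(d,n)\notin I$. For $I$ nice, $|I|$ is its cardinality and $\sigma_m(I)=\sum_{(i,j)\in I}((i-1)m+j)$ for an integer $m\ge0$. Define $G^-_{d,m,a,b}(n)=\sum_{I\in\mathcal{B}^-_{d,n}}\sigma_m(I)^a|I|^b$ (with $0^0=1$). $M_d(n)$ is defined by $M_d(-1)=0$, $M_d(0)=1$, $M_d(n)=M_d(n-1)+dM_d(n-2)$ for $n\ge1$. *)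

(* Defs.v *)
From HB Require Import structures.
From mathcomp Require Import all_boot all_order all_algebra.
From mathcomp Require Import fraction generic_quotient.
From mathcomp Require Import mpoly.

Set Implicit Arguments.
Unset Strict Implicit.
Unset Printing Implicit Defensive.

Import Order.TTheory GRing.Theory Num.Theory.

Local Open Scope ring_scope.

(* Indices are zero-based: the ordinal pair (i, j) : 'I_d * 'I_n stands for
   the cell (i + 1, j + 1) of the array {1..d} x {1..n}. *)
Definition nice (d n : nat) (I : {set 'I_d * 'I_n}) : bool :=
  [forall i : 'I_d, forall i' : 'I_d, forall j : 'I_n,
     (i' == i.+1 :> nat) && ((i', j) \in I) ==> ((i, j) \in I)]
  && [forall i : 'I_d, forall j : 'I_n, forall j' : 'I_n,
     [&& i == 0%N :> nat, j' == j.+1 :> nat & (i, j) \in I]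
       ==> ((i, j') \notin I)].

(* When n = 0 there is no cell (d, n), so the second condition is vacuous. *)
Definition Bminus (d n : nat) : {set {set 'I_d * 'I_n}} :=
  [set I | nice I &
     ~~ [exists c in I, (c.1.+1 == d :> nat) && (c.2.+1 == n :> nat)]].

Definition sigma (m d n : nat) (I : {set 'I_d * 'I_n}) : nat :=
  (\sum_(c in I) ((c.1.+1 - 1) * m + c.2.+1))%N.

Definition Gminus (d m a b n : nat) : nat :=
  (\sum_(I in Bminus d n) sigma m I ^ a * #|I| ^ b)%N.

(* [Mshift d k] is M_d(k - 1), so that the initial value M_d(-1) = 0 is
   [Mshift d 0]. *)
Fixpoint Mshift (d k : nat) : nat :=
  match k with
  | 0 => 0
  | 1 => 1
  | (k''.+1 as k').+1 => Mshift d k' + d * Mshift d k''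
  end.

Definition Md (d n : nat) : nat := Mshift d n.+1.

Notation ratfun := {fraction {poly rat}}.

(* Numerator and denominator of a rational function in lowest terms (up to a
   common nonzero scalar). *)
Definition rf_num (f : ratfun) : {poly rat} :=
  \n_(repr f) %/ gcdp \n_(repr f) \d_(repr f).
Definition rf_den (f : ratfun) : {poly rat} :=
  \d_(repr f) %/ gcdp \n_(repr f) \d_(repr f).

Definition rf_regular (f : ratfun) (x : rat) : bool := (rf_den f).[x] != 0.
(* Meaningful only where f is regular; see [rf_evalE]. *)
Definition rf_eval (x : rat) (f : ratfun) : rat :=
  (rf_num f).[x] / (rf_den f).[x].

(* Polynomials in m = 'X_0 and n = 'X_1, with coefficients in Q(d). *)
Definition coefs_regular (P : {mpoly ratfun[2]}) (d : nat) : Prop :=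
  forall u : 'X_{1..2}, rf_regular P@_u d%:R.

Definition mn_eval (P : {mpoly ratfun[2]}) (m n d : nat) : rat :=
  mmap (rf_eval d%:R) (fun i : 'I_2 => if i == 0%N :> nat then m%:R else n%:R) P.

Lemma rf_numden (f : ratfun) (p q : {poly rat}) : q != 0 ->
  f = FracField.tofrac p / FracField.tofrac q ->
  exists2 k, p = rf_num f * k & q = rf_den f * k.
Proof.
move=> q0 fE; rewrite /rf_num /rf_den; set u := \n_(repr f); set w := \d_(repr f).
have w0 : w != 0 by exact: denom_ratioP.
have e : u * q = w * p.
  have h : f * FracField.tofrac q = FracField.tofrac p.
    by rewrite fE divfK // tofrac_eq0.
  have h2 : f * FracField.tofrac w = FracField.tofrac u.
    rewrite -{1}[f]reprK.
    rewrite !piE; apply/eqP; rewrite -[_ == _]/(_ == _) piE /= /FracField.equivf.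
    by rewrite /FracField.mulf !numden_Ratio ?oner_eq0 ?mulr1 // mulrC.
  apply/eqP; rewrite -tofrac_eq !tofracM -h -h2; apply/eqP.
  by rewrite mulrCA mulrA.
set g := gcdp u w.
have g0 : g != 0 by rewrite gcdp_eq0 negb_and w0 orbT.
have uE : u = (u %/ g) * g by rewrite divpK // dvdp_gcdl.
have wE : w = (w %/ g) * g by rewrite divpK // dvdp_gcdr.
have cop : coprimep (w %/ g) (u %/ g).
  by rewrite coprimep_sym; apply: coprimep_div_gcd; rewrite w0 orbT.
have e' : (u %/ g) * q = (w %/ g) * p.
  by apply: (mulfI g0); rewrite !mulrA ![g * _]mulrC -uE -wE.
have dv : w %/ g %| q.
  by rewrite -(Gauss_dvdpr _ cop) e' dvdp_mulr.
have qE : q = (w %/ g) * (q %/ (w %/ g)) by rewrite mulrC divpK.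
exists (q %/ (w %/ g)) => //.
have w'0 : w %/ g != 0 by apply: contraNneq w0 => z; rewrite wE z mul0r.
by apply: (mulfI w'0); rewrite -e' {1}qE mulrCA.
Qed.

Lemma rf_evalE (f : ratfun) (p q : {poly rat}) (x : rat) : q.[x] != 0 ->
  f = FracField.tofrac p / FracField.tofrac q ->
  rf_regular f x /\ rf_eval x f = p.[x] / q.[x].
Proof.
move=> qx fE; have q0 : q != 0 by apply: contraNneq qx => ->; rewrite horner0.
have [k pE qE] := rf_numden q0 fE.
move: qx; rewrite /rf_regular /rf_eval qE pE !hornerM mulf_eq0 negb_or.
by case/andP=> dx kx; split=> //; rewrite -mulf_div divff // mulr1.
Qed.

(* Main.v *)
Require Import Defs.
From mathcomp Require Import all_boot all_order all_algebra.
From mathcomp Require Import fraction mpoly.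
From mathcomp Require Import generic_quotient ssrcomplements ring zify.

Set Implicit Arguments.
Unset Strict Implicit.
Unset Printing Implicit Defensive.

Import Order.TTheory GRing.Theory Num.Theory.

Local Open Scope ring_scope.

(* A nice set is determined by its column heights, no two consecutive ones being
   nonzero. Removing the last column (and the empty one before it, when the last
   one has height h > 0) gives, for the moments H_{a,b}(n) over all nice sets,
     H_{a,b}(n+2) = H_{a,b}(n+1) + d H_{a,b}(n) + S(n),
   where S involves only moments with smaller exponents. By induction on a + b,
   S = P M(n) + Q M(n+1) with P, Q of degree at most 2a + b - 1, so everything
   reduces to finding a particular solution A M(n) + B M(n+1) whose degree is one
   higher. This is done coefficient by coefficient, from the top power of n down;
   the linear system met at each step has determinant proportional to d (1 + 4d),
   whence denominators which do not vanish for d >= 1. *)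

(** * Column heights and the recurrence *)

Lemma card_ord_below (d k : nat) : (k <= d)%N -> #|[set i : 'I_d | (i < k)%N]| = k.
Proof.
move=> kd; rewrite -sum1_card (eq_bigl (fun i : 'I_d => (i < k)%N)); last first.
  by move=> i; rewrite inE.
by rewrite -(big_ord_widen d (fun=> 1%N) kd) sum1_card card_ord.
Qed.

(** If [i] is in [D], so is everything up to [i], which gives i + 1 elements; otherwise all of [D]
    lies below [i], which gives at most i. *)
Lemma downset_ordE (d : nat) (D : {set 'I_d}) (i : 'I_d) :
  (forall k k' : 'I_d, k' = k.+1 :> nat -> k' \in D -> k \in D) ->
  (i \in D) = (i < #|D|)%N.
Proof.
move=> Ddown.
have down (s : nat) (k k' : 'I_d) : k' = (k + s)%N :> nat -> k' \in D -> k \in D.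
  elim: s k' => [|s IH] k' k'E k'D.
    by rewrite -(_ : k' = k) //; apply/val_inj; rewrite /= k'E addn0.
  have lt : (k + s < d)%N by rewrite (leq_trans _ (ltn_ord k')) // k'E addnS.
  by apply: (IH (Ordinal lt)) => //; apply: Ddown k'D; rewrite k'E addnS.
apply/idP/idP => [iD|].
  rewrite -[X in (X <= _)%N](@card_ord_below d) //; apply/subset_leq_card/subsetP => k.
  by rewrite inE ltnS => ki; apply: (down (i - k)%N) iD; rewrite subnKC.
apply: contraTT => iD; rewrite -leqNgt -[X in (_ <= X)%N](@card_ord_below d i); last exact: ltnW.
apply/subset_leq_card/subsetP => k kD; rewrite inE ltnNge.
by apply: contra iD => ik; apply: (down (k - i)%N) kD; rewrite subnKC.
Qed.

Definition cells (d n : nat) (f : {ffun 'I_n -> 'I_d.+1}) : {set 'I_d * 'I_n} :=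
  [set c : 'I_d * 'I_n | (c.1 < f c.2)%N].

(** [inord] never truncates here, since a column has at most d cells. *)
Definition heights (d n : nat) (I : {set 'I_d * 'I_n}) : {ffun 'I_n -> 'I_d.+1} :=
  [ffun j => inord #|[set i | (i, j) \in I]|].

Definition sparse (d n : nat) (f : {ffun 'I_n -> 'I_d.+1}) : bool :=
  [forall j : 'I_n, forall j' : 'I_n,
     (j' == j.+1 :> nat) && (f j != 0%N :> nat) ==> (f j' == 0%N :> nat)].

(** Vacuously true when n = 0, so that a first column may take any height. *)
Definition last_empty (d n : nat) (f : {ffun 'I_n -> 'I_d.+1}) : bool :=
  [forall j : 'I_n, (j.+1 == n :> nat) ==> (f j == 0%N :> nat)].

Lemma cellsK (d n : nat) : cancel (@cells d n) (@heights d n).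
Proof.
move=> f; apply/ffunP => j; rewrite ffunE -[RHS]inord_val; congr inord.
rewrite -[RHS](@card_ord_below d); last by rewrite -ltnS.
by apply: eq_card => i; rewrite !inE.
Qed.

Lemma heightsK (d n : nat) (I : {set 'I_d * 'I_n}) : nice I -> cells (heights I) = I.
Proof.
case/andP=> /forallP down _; apply/setP => -[i j]; rewrite inE ffunE /= inordK; last first.
  by rewrite ltnS (leq_trans (max_card _)) // card_ord.
rewrite -downset_ordE ?inE // => k k' k'E; rewrite !inE => k'I.
by have /forallP/(_ k')/forallP/(_ j)/implyP := down k; apply; rewrite k'E eqxx.
Qed.

(** Condition (1) is automatic for columns filled from row 1 on; condition (2) only looks at row 1,
    which is occupied exactly in the columns of nonzero height. *)
Lemma nice_cells (d n : nat) (f : {ffun 'I_n -> 'I_d.+1}) : nice (cells f) = sparse f.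
Proof.
apply/andP/forallP => [[_ /forallP H] j|H].
  apply/forallP => j'; apply/implyP => /andP[j'E fj].
  have d0 : (0 < d)%N by rewrite -lt0n in fj; rewrite (leq_trans fj) // -ltnS.
  have /forallP/(_ j)/forallP/(_ j')/implyP := H (Ordinal d0).
  by rewrite j'E !inE /= lt0n fj => /(_ isT); rewrite -leqNgt leqn0.
split.
  apply/forallP => i; apply/forallP => i'; apply/forallP => j; apply/implyP.
  by rewrite !inE /= => /andP[/eqP ->]; apply: ltnW.
apply/forallP => i; apply/forallP => j; apply/forallP => j'; apply/implyP.
case/and3P => /eqP i0 j'E; rewrite !inE /= i0 lt0n => fj.
have /forallP/(_ j')/implyP := H j.
by rewrite j'E fj => /(_ isT) /eqP ->.
Qed.

Lemma sum_cells (d n : nat) (f : {ffun 'I_n -> 'I_d.+1}) (F : nat -> nat -> nat) :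
  (\sum_(c in cells f) F c.1 c.2 = \sum_j \sum_(i < f j) F i j)%N.
Proof.
transitivity (\sum_(j < n) \sum_(i < d | (i < f j)%N) F i j)%N.
  rewrite (exchange_big_dep xpredT) //= pair_big_dep /=.
  by apply: eq_bigl => c; rewrite inE.
by apply: eq_bigr => j _; rewrite (big_ord_widen d (fun i => F i j)) // -ltnS.
Qed.

(* Contribution to [sigma m] of a column of height h whose one-based index is j. *)
Definition colwt (m h j : nat) : nat := ('C(h, 2) * m + h * j)%N.

Lemma sum_colwt (m h j : nat) : (\sum_(i < h) (i * m + j) = colwt m h j)%N.
Proof.
elim: h => [|h IH]; first by rewrite big_ord0 /colwt bin0n.
rewrite big_ord_recr /= IH /colwt binS bin1 mulnDl mulSn; ring.
Qed.

Definition wt (m d n : nat) (f : {ffun 'I_n -> 'I_d.+1}) : nat :=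
  (\sum_j colwt m (f j) j.+1)%N.
Definition ht (d n : nat) (f : {ffun 'I_n -> 'I_d.+1}) : nat := (\sum_j f j)%N.

Lemma sigma_cells (m d n : nat) (f : {ffun 'I_n -> 'I_d.+1}) : sigma m (cells f) = wt m f.
Proof.
rewrite /sigma (sum_cells f (fun i j => ((i.+1 - 1) * m + j.+1)%N)).
by apply: eq_bigr => j _; rewrite -sum_colwt; apply: eq_bigr => i _; rewrite subn1.
Qed.

Lemma card_cells (d n : nat) (f : {ffun 'I_n -> 'I_d.+1}) : #|cells f| = ht f.
Proof.
rewrite -sum1_card (sum_cells f (fun _ _ => 1%N)).
by apply: eq_bigr => j _; rewrite sum1_card card_ord.
Qed.

(** * Appending a last column *)

Definition snoc (T : Type) (n : nat) (f : {ffun 'I_n -> T}) (h : T) : {ffun 'I_n.+1 -> T} :=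
  [ffun j => if unlift ord_max j is Some j' then f j' else h].

Lemma snoc_max (T : Type) (n : nat) (f : {ffun 'I_n -> T}) (h : T) : snoc f h ord_max = h.
Proof. by rewrite ffunE unlift_none. Qed.

Lemma widen_max (n : nat) (j : 'I_n) : widen_ord (leqnSn n) j = lift ord_max j.
Proof. by apply/val_inj; rewrite /= /bump leqNgt ltn_ord. Qed.

Lemma snoc_widen (T : Type) (n : nat) (f : {ffun 'I_n -> T}) (h : T) (j : 'I_n) :
  snoc f h (widen_ord (leqnSn n) j) = f j.
Proof. by rewrite ffunE widen_max liftK. Qed.

Lemma sum_snoc (T : finType) (n : nat) (V : nmodType) (P : pred {ffun 'I_n.+1 -> T})
    (F : {ffun 'I_n.+1 -> T} -> V) :
  \sum_(g | P g) F g = \sum_h \sum_(f | P (snoc f h)) F (snoc f h).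
Proof.
rewrite pair_big_dep /=.
rewrite (reindex (fun p : T * {ffun 'I_n -> T} => snoc p.2 p.1)) //=.
exists (fun g => (g ord_max, [ffun j => g (widen_ord (leqnSn n) j)])) => [[h f]|g] _ /=.
  by rewrite snoc_max; congr pair; apply/ffunP => j; rewrite ffunE snoc_widen.
apply/ffunP => j; rewrite ffunE; case: unliftP => [j' ->|->] //.
by rewrite ffunE widen_max.
Qed.

Lemma forall_ord_recr (n : nat) (P : pred 'I_n.+1) :
  [forall j, P j] = [forall j : 'I_n, P (widen_ord (leqnSn n) j)] && P ord_max.
Proof.
apply/forallP/andP => [H|[/forallP H Hmax] j]; first by split=> //; apply/forallP.
by case: (unliftP ord_max j) => [j' ->|->//]; rewrite -widen_max.
Qed.

(** A pair of consecutive columns lies inside [f] or consists of the last column of [f] and the new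
    one; nothing follows the new one. *)
Lemma sparse_snoc (d n : nat) (f : {ffun 'I_n -> 'I_d.+1}) (h : 'I_d.+1) :
  sparse (snoc f h) = sparse f && ((h == 0%N :> nat) || last_empty f).
Proof.
rewrite {1}/sparse forall_ord_recr [X in _ && X](_ : _ = true); last first.
  by apply/forallP => j'; rewrite /= ltn_eqF.
rewrite andbT.
under eq_forallb => j do rewrite forall_ord_recr /= snoc_widen snoc_max.
apply/forallP/andP => [H|[/forallP Hs Hl] j]; last first.
  apply/andP; split; first apply/forallP => j'.
    by rewrite snoc_widen; have /forallP := Hs j; apply.
  apply/implyP => /= /andP[nj fj]; case/orP: Hl => // /forallP/(_ j).
  by rewrite eq_sym nj /= (negPf fj).
split.
  apply/forallP => j; apply/forallP => j'.
  by have /andP[/forallP/(_ j')] := H j; rewrite snoc_widen.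
case: eqP => //= h0; apply/forallP => j; apply/implyP; rewrite eq_sym => nj.
have /andP[_ /implyP] /= := H j; rewrite nj /=.
by case: eqP => //= _ /(_ isT)/eqP/h0.
Qed.

Lemma last_empty_snoc (d n : nat) (f : {ffun 'I_n -> 'I_d.+1}) (h : 'I_d.+1) :
  last_empty (snoc f h) = (h == 0%N :> nat).
Proof.
rewrite /last_empty forall_ord_recr /= eqxx snoc_max.
rewrite [X in X && _](_ : _ = true) //.
by apply/forallP => j; rewrite /= eqSS ltn_eqF.
Qed.

Lemma wt_snoc (m d n : nat) (f : {ffun 'I_n -> 'I_d.+1}) (h : 'I_d.+1) :
  wt m (snoc f h) = (wt m f + colwt m h n.+1)%N.
Proof.
rewrite /wt big_ord_recr /= snoc_max; congr addn.
by apply: eq_bigr => j _; rewrite snoc_widen.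
Qed.

Lemma ht_snoc (d n : nat) (f : {ffun 'I_n -> 'I_d.+1}) (h : 'I_d.+1) :
  ht (snoc f h) = (ht f + h)%N.
Proof.
rewrite /ht big_ord_recr /= snoc_max; congr addn.
by apply: eq_bigr => j _; rewrite snoc_widen.
Qed.

(* [nice_sum d m k phi] is the sum of phi(sigma_m(I), |I|) over all nice subsets
   I of A_{d,k-2}; the values at k = 0, 1 extend the recurrence downwards. *)
Fixpoint nice_sum (d m k : nat) (phi : nat -> nat -> rat) : rat :=
  match k with
  | 0 => 0
  | 1 => phi 0%N 0%N
  | (k''.+1 as k').+1 =>
      nice_sum d m k' phi +
      \sum_(h < d) nice_sum d m k'' (fun s c => phi (s + colwt m h.+1 k'')%N (c + h.+1)%N)
  end.

Lemma colwt0 (m j : nat) : colwt m 0 j = 0%N.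
Proof. by []. Qed.

(** An empty last column adds nothing to either statistic and constrains nothing before it. *)
Lemma sum_last_empty (d m n : nat) (phi : nat -> nat -> rat) :
  \sum_(g : {ffun 'I_n.+1 -> 'I_d.+1} | sparse g && last_empty g) phi (wt m g) (ht g) =
  \sum_(f : {ffun 'I_n -> 'I_d.+1} | sparse f) phi (wt m f) (ht f).
Proof.
rewrite sum_snoc big_ord_recl /= [X in _ + X]big1 => [|h _]; last first.
  by apply: big_pred0 => f; rewrite last_empty_snoc andbF.
rewrite addr0; apply: eq_big => [f|f _]; first by rewrite sparse_snoc last_empty_snoc !andbT.
by rewrite wt_snoc ht_snoc colwt0 !addn0.
Qed.

Lemma sum_sparse_top (d m n : nat) (h : 'I_d.+1) (phi : nat -> nat -> rat) : h != 0%N :> nat ->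
  \sum_(f : {ffun 'I_n -> 'I_d.+1} | sparse (snoc f h)) phi (wt m (snoc f h)) (ht (snoc f h)) =
  \sum_(f : {ffun 'I_n -> 'I_d.+1} | sparse f && last_empty f)
     phi (wt m f + colwt m h n.+1)%N (ht f + h)%N.
Proof.
move=> /negPf h0; apply: eq_big => [f|f _]; first by rewrite sparse_snoc h0.
by rewrite wt_snoc ht_snoc.
Qed.

Lemma sum_sparse_top0 (d m n : nat) (phi : nat -> nat -> rat) :
  \sum_(f : {ffun 'I_n -> 'I_d.+1} | sparse (snoc f ord0))
     phi (wt m (snoc f ord0)) (ht (snoc f ord0)) =
  \sum_(f : {ffun 'I_n -> 'I_d.+1} | sparse f) phi (wt m f) (ht f).
Proof.
apply: eq_big => [f|f _]; first by rewrite sparse_snoc andbT.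
by rewrite wt_snoc ht_snoc !addn0.
Qed.

Lemma sum_ffun0 (d m : nat) (P : pred {ffun 'I_0 -> 'I_d.+1}) (phi : nat -> nat -> rat) :
  (forall f, P f) -> \sum_(f | P f) phi (wt m f) (ht f) = phi 0%N 0%N.
Proof.
move=> PT; rewrite (eq_bigl xpredT) => [|f]; last exact: PT.
rewrite (eq_bigr (fun=> phi 0%N 0%N)) => [|f _]; last by rewrite /wt /ht !big_ord0.
by rewrite sumr_const card_ffun !card_ord expn0.
Qed.

(** Both sums are needed at once: over n + 1 columns, a zero last height leaves all sparse sequences
    on n columns, a nonzero one only those whose last column is empty. [phi] is generalized because
    the second case shifts its arguments. *)
Lemma nice_sumE (d m n : nat) (phi : nat -> nat -> rat) :
  \sum_(f : {ffun 'I_n -> 'I_d.+1} | sparse f) phi (wt m f) (ht f) = nice_sum d m n.+2 phi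
  /\ \sum_(f : {ffun 'I_n -> 'I_d.+1} | sparse f && last_empty f) phi (wt m f) (ht f)
     = nice_sum d m n.+1 phi.
Proof.
elim: n phi => [|n IH] phi.
  split; rewrite sum_ffun0 //=; first by rewrite big1 ?addr0.
  - by move=> f; apply/forallP => -[].
  - by move=> f; apply/andP; split; apply/forallP => -[].
rewrite sum_last_empty (IH phi).1; split=> //.
rewrite sum_snoc big_ord_recl sum_sparse_top0 (IH phi).1; congr (_ + _).
apply: eq_bigr => h _; rewrite sum_sparse_top; last by [].
exact: (IH (fun s c => phi (s + colwt m h.+1 n.+1)%N (c + h.+1)%N)).2.
Qed.

(** The excluded cell belongs to a nice set exactly when the last column is full, so the last height
    runs over 0, ..., d - 1: height 0 gives the first term, the others the sum over [h]. For n = 0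
    that sum vanishes, since [nice_sum] is 0 at index 0. *)
Lemma GminusE (d m a b n : nat) : (0 < d)%N ->
  let phi (s c : nat) : rat := s%:R ^+ a * c%:R ^+ b in
  (Gminus d m a b n)%:R = nice_sum d m n.+1 phi
    + \sum_(h < d.-1) nice_sum d m n (fun s c => phi (s + colwt m h.+1 n)%N (c + h.+1)%N).
Proof.
case: d => // d _ phi; rewrite /Gminus natr_sum.
rewrite (eq_bigr (fun I => phi (sigma m I) #|I|)) => [|I _]; last first.
  by rewrite natrM !natrX.
transitivity (\sum_(f : {ffun 'I_n -> 'I_d.+2} |
    sparse f && ~~ [exists j, (f j == d.+1 :> nat) && (j.+1 == n)]) phi (wt m f) (ht f)).
  rewrite (reindex_onto (@cells _ _) (@heights _ _)) /=; last first.
    by move=> I; rewrite inE => /andP[/heightsK].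
  apply: eq_big => [f|f _]; last by rewrite sigma_cells card_cells.
  rewrite cellsK eqxx andbT inE nice_cells; congr (_ && ~~ _).
  apply/existsP/existsP => [[[i j]]|[j /andP[/eqP fj jn]]].
    rewrite inE /= eqSS => /and3P[lt /eqP i_d jn]; exists j; rewrite jn andbT.
    by rewrite i_d in lt; rewrite eqn_leq lt andbT -ltnS.
  by exists (ord_max, j); rewrite inE /= fj ltnSn eqxx jn.
case: n => [|n].
  rewrite [X in _ + X]big1 //= addr0 sum_ffun0 // => f; apply/andP; split.
    by apply/forallP => -[].
  by apply/existsPn => -[].
have topE (f : {ffun 'I_n -> 'I_d.+2}) h :
    [exists j, (snoc f h j == d.+1 :> nat) && (j.+1 == n.+1)] = (h == d.+1 :> nat).
  apply/existsP/idP => [[j /andP[]]|hd]; last by exists ord_max; rewrite snoc_max hd eqxx.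
  by rewrite eqSS => jh /eqP jn; rewrite -(snoc_max f h) -(_ : j = ord_max) //; apply/val_inj.
rewrite sum_snoc big_ord_recr /= [X in _ + X]big_pred0 ?addr0 => [|f]; last first.
  by rewrite topE /= eqxx andbF.
rewrite big_ord_recl; congr (_ + _).
  rewrite -[RHS](nice_sumE _ _ _ _).1 -[RHS]sum_sparse_top0.
  rewrite (_ : widen_ord _ _ = ord0); last exact/val_inj.
  by apply: eq_bigl => f; rewrite topE andbT.
apply: eq_bigr => h _; set h' := widen_ord _ _.
rewrite (eq_bigl (fun f => sparse (snoc f h'))) => [|f]; last first.
  by rewrite topE /= /bump /= eqSS ltn_eqF ?andbT // ltn_ord.
rewrite sum_sparse_top; last by [].
exact: (nice_sumE _ _ _ (fun s c => phi (s + colwt m h.+1 n.+1)%N (c + h.+1)%N)).2.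
Qed.

(** * Polynomials in m and n over the functions of d regular at d >= 1 *)

(** Plain functions on [nat] rather than elements of [ratfun], so that [ring] and [field] work
    pointwise; conversion to fractions is postponed to the end. *)
Definition regfun (c : nat -> rat) : Prop :=
  exists p q : {poly rat}, forall d : nat, (0 < d)%N ->
    q.[d%:R] != 0 /\ c d = p.[d%:R] / q.[d%:R].

Lemma regfun_ext (c c' : nat -> rat) :
  (forall d, (0 < d)%N -> c d = c' d) -> regfun c -> regfun c'.
Proof.
by move=> e [p [q H]]; exists p, q => d d0; rewrite -e //; apply: H.
Qed.

Lemma regfun_poly (p : {poly rat}) : regfun (fun d => p.[d%:R]).
Proof. by exists p, 1 => d _; rewrite hornerC divr1. Qed.

Lemma regfunC (x : rat) : regfun (fun=> x).
Proof. by apply: regfun_ext (regfun_poly x%:P) => d _; rewrite hornerC. Qed.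

Lemma regfun_id : regfun (fun d => d%:R).
Proof. by apply: regfun_ext (regfun_poly 'X) => d _; rewrite hornerX. Qed.

Lemma regfunD (c c' : nat -> rat) : regfun c -> regfun c' -> regfun (fun d => c d + c' d).
Proof.
move=> [p [q H]] [p' [q' H']]; exists (p * q' + p' * q), (q * q') => d d0.
have [[q0 ->] [q'0 ->]] := (H d d0, H' d d0).
by rewrite !(hornerM, hornerD) mulf_neq0 // addf_div.
Qed.

Lemma regfunM (c c' : nat -> rat) : regfun c -> regfun c' -> regfun (fun d => c d * c' d).
Proof.
move=> [p [q H]] [p' [q' H']]; exists (p * p'), (q * q') => d d0.
have [[q0 ->] [q'0 ->]] := (H d d0, H' d d0).
by rewrite !hornerM mulf_neq0 // mulf_div.
Qed.

Lemma regfunV (c : nat -> rat) :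
  (forall d, (0 < d)%N -> c d != 0) -> regfun c -> regfun (fun d => (c d)^-1).
Proof.
move=> c0 [p [q H]]; exists q, p => d d0.
have [q0 cE] := H d d0; have := c0 d d0; rewrite cE mulf_eq0 negb_or => /andP[p0 _].
by rewrite invf_div.
Qed.

Lemma regfunN (c : nat -> rat) : regfun c -> regfun (fun d => - c d).
Proof.
by move=> /(regfunM (regfunC (-1))); apply: regfun_ext => d _; rewrite mulN1r.
Qed.

(** [D] bounds the total degree in m and n. The clause [polyfun_ext] replaces functional
    extensionality and restricts all claims to d >= 1. *)
Inductive polyfun (D : nat) : (nat -> nat -> nat -> rat) -> Prop :=
| polyfun_mono (c : nat -> rat) (i j : nat) : regfun c -> (i + j <= D)%N ->
    polyfun D (fun d m n => c d * m%:R ^+ i * n%:R ^+ j)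
| polyfunD f g : polyfun D f -> polyfun D g -> polyfun D (fun d m n => f d m n + g d m n)
| polyfun_ext f g : (forall d m n, (0 < d)%N -> f d m n = g d m n) ->
    polyfun D f -> polyfun D g.

Lemma polyfun_le (D D' : nat) f : (D <= D')%N -> polyfun D f -> polyfun D' f.
Proof.
move=> le; elim=> {f} [c i j rc ij|f g _ Hf _ Hg|f g e _ Hf].
- by apply: polyfun_mono => //; apply: leq_trans le.
- exact: polyfunD.
- exact: polyfun_ext Hf.
Qed.

Lemma polyfun_reg (c : nat -> rat) : regfun c -> polyfun 0 (fun d _ _ => c d).
Proof.
move=> rc; apply: polyfun_ext (polyfun_mono rc (leqnn (0 + 0))) => d m n _.
by rewrite !mulr1.
Qed.

Lemma polyfun_m : polyfun 1 (fun _ m _ => m%:R).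
Proof.
apply: polyfun_ext (polyfun_mono (regfunC 1) (leqnn (1 + 0))) => d m n _.
by rewrite mul1r mulr1.
Qed.

Lemma polyfun_n : polyfun 1 (fun _ _ n => n%:R).
Proof.
apply: polyfun_ext (polyfun_mono (regfunC 1) (leqnn (0 + 1))) => d m n _.
by rewrite mulr1 mul1r.
Qed.

Lemma polyfunM (D D' : nat) f g :
  polyfun D f -> polyfun D' g -> polyfun (D + D') (fun d m n => f d m n * g d m n).
Proof.
elim=> {f} [c i j rc ij|f f' _ Hf _ Hf'|f f' e _ Hf] Hg; last first.
- by apply: polyfun_ext (Hf Hg) => d m n d0; rewrite e.
- by apply: polyfun_ext (polyfunD (Hf Hg) (Hf' Hg)) => d m n _; rewrite mulrDl.
elim: Hg => {g} [c' i' j' rc' ij'|g g' _ Hg _ Hg'|g g' e _ Hg].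
- have ijij' : ((i + i') + (j + j') <= D + D')%N by rewrite addnACA leq_add.
  apply: polyfun_ext (polyfun_mono (regfunM rc rc') ijij') => d m n _.
  by rewrite !exprD; ring.
- by apply: polyfun_ext (polyfunD Hg Hg') => d m n _; rewrite mulrDr.
- by apply: polyfun_ext Hg => d m n d0; rewrite e.
Qed.

Lemma polyfunZ (D : nat) (c : nat -> rat) f :
  regfun c -> polyfun D f -> polyfun D (fun d m n => c d * f d m n).
Proof. by move=> rc; apply: polyfunM (polyfun_reg rc). Qed.

Lemma polyfunN (D : nat) f : polyfun D f -> polyfun D (fun d m n => - f d m n).
Proof.
by move=> /(polyfunZ (regfunC (-1))); apply: polyfun_ext => d m n _; rewrite mulN1r.
Qed.

Lemma polyfunX (D k : nat) f : polyfun D f -> polyfun (k * D) (fun d m n => f d m n ^+ k).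
Proof.
move=> Hf; elim: k => [|k IH]; first exact: polyfun_reg (regfunC 1).
by rewrite mulSn; apply: polyfun_ext (polyfunM Hf IH) => d m n _; rewrite exprS.
Qed.

Lemma polyfun0 (D : nat) : polyfun D (fun _ _ _ => 0).
Proof. exact: polyfun_le (leq0n D) (polyfun_reg (regfunC 0)). Qed.

Lemma polyfun_sum (D : nat) (I : Type) (r : seq I) (P : pred I)
    (F : I -> nat -> nat -> nat -> rat) : (forall i, P i -> polyfun D (F i)) ->
  polyfun D (fun d m n => \sum_(i <- r | P i) F i d m n).
Proof.
move=> H; elim: r => [|i r IH].
  by apply: polyfun_ext (polyfun0 D) => d m n _; rewrite big_nil.
case Pi: (P i); last by apply: polyfun_ext IH => d m n _; rewrite big_cons Pi.
by apply: polyfun_ext (polyfunD (H i Pi) IH) => d m n _; rewrite big_cons Pi.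
Qed.

Lemma polyfun_shift (D : nat) f : polyfun D f -> polyfun D (fun d m n => f d m n.+1).
Proof.
elim=> {f} [c i j rc ij|f f' _ Hf _ Hf'|f f' e _ Hf]; last first.
- by apply: polyfun_ext Hf => d m n d0; rewrite e.
- exact: polyfunD.
have Hn1 : polyfun 1 (fun _ _ n => n%:R + 1).
  exact: polyfunD polyfun_n (polyfun_le (leq0n 1) (polyfun_reg (regfunC 1))).
have := polyfunM (polyfunZ rc (polyfunX i polyfun_m)) (polyfunX j Hn1).
rewrite !muln1 => /(polyfun_le ij); apply: polyfun_ext => d m n _.
by rewrite -natr1.
Qed.

Lemma polyfun_subst (D s : nat) f : polyfun D f -> polyfun D (fun d m _ => f d m s).
Proof.
elim=> {f} [c i j rc ij|f f' _ Hf _ Hf'|f f' e _ Hf]; last first.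
- by apply: polyfun_ext Hf => d m n d0; rewrite e.
- exact: polyfunD.
have ij0 : (i + 0 <= D)%N by rewrite addn0 (leq_trans (leq_addr j i)).
apply: polyfun_ext (polyfun_mono (regfunM rc (regfunC (s%:R ^+ j))) ij0) => d m n _.
by rewrite mulr1 mulrAC.
Qed.

(* Substituting A(n) M(n) + B(n) M(n+1) into X(n+2) - X(n+1) - d X(n) and reducing
   M(n+2), M(n+3) to M(n), M(n+1) gives P(n) M(n) + Q(n) M(n+1), with these P and Q. *)
Definition solvable (D : nat) (P Q : nat -> nat -> nat -> rat) : Prop :=
  exists A B : nat -> nat -> nat -> rat,
    [/\ polyfun D A, polyfun D B &
      forall d m n, (0 < d)%N ->
        P d m n = d%:R * (A d m n.+2 + B d m n.+2 - B d m n.+1 - A d m n) /\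
        Q d m n = A d m n.+2 + (1 + d%:R) * B d m n.+2 - A d m n.+1 - B d m n.+1
                  - d%:R * B d m n].

Lemma solvable_ext (D : nat) P Q P' Q' :
  (forall d m n, (0 < d)%N -> P d m n = P' d m n) ->
  (forall d m n, (0 < d)%N -> Q d m n = Q' d m n) -> solvable D P Q -> solvable D P' Q'.
Proof.
move=> eP eQ [A [B [HA HB H]]]; exists A, B; split=> // d m n d0.
by rewrite -eP // -eQ //; apply: H.
Qed.

Lemma solvableD (D : nat) P Q P' Q' : solvable D P Q -> solvable D P' Q' ->
  solvable D (fun d m n => P d m n + P' d m n) (fun d m n => Q d m n + Q' d m n).
Proof.
move=> [A [B [HA HB H]]] [A' [B' [HA' HB' H']]].
eexists; eexists; split; [exact: polyfunD HA HA'|exact: polyfunD HB HB'|] => d m n d0.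
have [[-> ->] [-> ->]] := (H d m n d0, H' d m n d0).
by split; ring.
Qed.

Lemma solvable_sum (D N : nat) (P Q : nat -> nat -> nat -> nat -> rat) :
  (forall l, (l < N)%N -> solvable D (P l) (Q l)) ->
  solvable D (fun d m n => \sum_(l < N) P l d m n) (fun d m n => \sum_(l < N) Q l d m n).
Proof.
elim: N => [|N IH] H.
  exists (fun _ _ _ => 0), (fun _ _ _ => 0); split; try exact: polyfun0.
  by move=> d m n d0; rewrite !big_ord0; split; ring.
have HN := IH (fun l lN => H l (ltnW lN)).
by apply: solvable_ext (solvableD HN (H N (leqnn _))) => d m n _; rewrite big_ord_recr.
Qed.

(** The two top terms are split off: the first cancels in differences, the second becomes the
    leading term. *)
Lemma expr_shift (x s : rat) (j : nat) :
  (x + s) ^+ j.+1 = x ^+ j.+1 + s * j.+1%:R * x ^+ j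
    + \sum_(l < j) 'C(j.+1, l)%:R * s ^+ (j.+1 - l) * x ^+ l.
Proof.
rewrite addrC exprDn !big_ord_recr /= subnn binn subSnn expr1 binSn.
rewrite (eq_bigr (fun l : 'I_j => 'C(j.+1, l)%:R * s ^+ (j.+1 - l) * x ^+ l)) => [|l _].
  by rewrite expr0 -mulr_natr; ring.
by rewrite -mulr_natl mulrA.
Qed.

(** Ansatz A = al m^i n^(j+1), B = be m^i n^(j+1). The terms in n^(j+1) cancel in both equations;
    those in n^j give p = d (j+1) (2 al + be) and q = (j+1) (al + (1 + 2d) be). The lower powers of
    n are left to the induction hypothesis. *)
Lemma solvable_mono (D i j : nat) (p q : nat -> rat) : regfun p -> regfun q ->
  (i + j < D)%N -> solvable D (fun d m n => p d * m%:R ^+ i * n%:R ^+ j)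
                              (fun d m n => q d * m%:R ^+ i * n%:R ^+ j).
Proof.
elim/ltn_ind: j p q => j IH p q rp rq ijD.
pose J : rat := j.+1%:R.
pose det (d : nat) : rat := 1 + 4 * d%:R.
pose p' (d : nat) := p d * (d%:R^-1 * J^-1).
pose q' (d : nat) := q d * J^-1.
(* Cramer's rule for the system with rows (2, 1) and (1, 1 + 2d), whose determinant is [det d]. *)
pose al (d : nat) := ((1 + 2 * d%:R) * p' d - q' d) * (det d)^-1.
pose be (d : nat) := (2 * q' d - p' d) * (det d)^-1.
have J0 : J != 0 by rewrite pnatr_eq0.
have d_neq0 (d : nat) : (0 < d)%N -> d%:R != 0 :> rat by rewrite pnatr_eq0 -lt0n.
have det0 (d : nat) : (0 < d)%N -> det d != 0.
  by move=> _; rewrite /det -(natrM _ 4) -(natrD _ 1) pnatr_eq0.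
have rdet : regfun (fun d => (det d)^-1).
  by apply: regfunV => //; apply/regfunD/regfunM/regfun_id; apply: regfunC.
have rp' : regfun p'.
  by apply: regfunM rp (regfunM (regfunV d_neq0 regfun_id) (regfunC _)).
have rq' : regfun q' by apply: regfunM rq (regfunC _).
have ral : regfun al.
  apply: regfunM rdet; apply: regfunD (regfunN rq'); apply: regfunM rp'.
  by apply/regfunD/regfunM/regfun_id; apply: regfunC.
have rbe : regfun be.
  by apply: regfunM rdet; apply: regfunD (regfunN rp'); apply: regfunM rq'; apply: regfunC.
have alE d : (0 < d)%N -> p d = d%:R * J * (2 * al d + be d).
  move=> d0; have := det0 d d0; have := d_neq0 d d0.
  by rewrite /al /be /p' /q' /det => d1 d2; field; rewrite ?d1 ?d2 ?nat1r ?pnatr_eq0.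
have beE d : (0 < d)%N -> q d = J * (al d + (1 + 2 * d%:R) * be d).
  move=> d0; have := det0 d d0; have := d_neq0 d d0.
  by rewrite /al /be /p' /q' /det => d1 d2; field; rewrite ?d1 ?d2 ?nat1r ?pnatr_eq0.
(* [r s l] is the coefficient of n^l in (n + s)^(j+1); [rem0] and [rem1] are minus the coefficients
   of m^i n^l, l < j, that the ansatz produces in the two equations. *)
pose r (s : rat) l : rat := 'C(j.+1, l)%:R * s ^+ (j.+1 - l).
pose rem0 l (d : nat) := - (d%:R * ((al d + be d) * r 2 l - be d * r 1 l)).
pose rem1 l (d : nat) := - ((al d + (1 + d%:R) * be d) * r 2 l - (al d + be d) * r 1 l).
have rrem0 l : regfun (rem0 l).
  apply/regfunN/regfunM; first exact: regfun_id.
  apply/regfunD/regfunN/regfunM/regfunC => //.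
  by apply: regfunM (regfunC _); apply: regfunD.
have rrem1 l : regfun (rem1 l).
  apply/regfunN/regfunD/regfunN.
    apply: regfunM (regfunC _); apply: regfunD ral (regfunM _ rbe).
    exact: regfunD (regfunC 1) regfun_id.
  by apply: regfunM (regfunC _); apply: regfunD.
have lead : solvable D
    (fun d m n => p d * m%:R ^+ i * n%:R ^+ j - \sum_(l < j) rem0 l d * m%:R ^+ i * n%:R ^+ l)
    (fun d m n => q d * m%:R ^+ i * n%:R ^+ j - \sum_(l < j) rem1 l d * m%:R ^+ i * n%:R ^+ l).
  exists (fun d m n => al d * m%:R ^+ i * n%:R ^+ j.+1).
  exists (fun d m n => be d * m%:R ^+ i * n%:R ^+ j.+1).
  split=> [||d m n d0]; [by apply: polyfun_mono; rewrite ?addnS..|].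
  rewrite -[n.+2]addn2 -[n.+1]addn1 !natrD !expr_shift -/J.
  set x : rat := n%:R; set R2 := \sum_(l < j) 'C(_, _)%:R * 2%:R ^+ _ * _.
  set R1 := \sum_(l < j) 'C(_, _)%:R * 1%:R ^+ _ * _.
  have rem0E : \sum_(l < j) rem0 l d * m%:R ^+ i * x ^+ l
      = - (d%:R * m%:R ^+ i * ((al d + be d) * R2 - be d * R1)).
    rewrite /R2 /R1 !mulr_sumr -sumrB mulr_sumr -sumrN; apply: eq_bigr => l _.
    by rewrite /rem0 /r; ring.
  have rem1E : \sum_(l < j) rem1 l d * m%:R ^+ i * x ^+ l
      = - (m%:R ^+ i * ((al d + (1 + d%:R) * be d) * R2 - (al d + be d) * R1)).
    rewrite /R2 /R1 !mulr_sumr -sumrB mulr_sumr -sumrN; apply: eq_bigr => l _.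
    by rewrite /rem1 /r; ring.
  by rewrite rem0E rem1E (alE d d0) (beE d d0); split; rewrite !exprS; ring.
have low := @solvable_sum D j _ _ (fun l lj => IH l lj _ _ (rrem0 l) (rrem1 l)
              (leq_ltn_trans (leq_add (leqnn i) (ltnW lj)) ijD)).
by apply: solvable_ext (solvableD lead low) => d m n _; rewrite subrK.
Qed.

(** By linearity [P] and [Q] can be treated one at a time, each by induction on its construction
    from monomials. As in summation, the degree grows by one. *)
Lemma polyfun_solvable (D : nat) P Q : polyfun D P -> polyfun D Q -> solvable D.+1 P Q.
Proof.
have S0 : solvable D.+1 (fun _ _ _ => 0) (fun _ _ _ => 0).
  exists (fun _ _ _ => 0), (fun _ _ _ => 0); split; try exact: polyfun0.
  by move=> d m n _; split; ring.
move=> HP HQ; suff [SP SQ] : solvable D.+1 P (fun _ _ _ => 0) /\ solvable D.+1 (fun _ _ _ => 0) Q.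
  by apply: solvable_ext (solvableD SP SQ) => d m n _; rewrite ?addr0 ?add0r.
split.
  elim: HP => {P} [c i j rc ij|f f' _ Hf _ Hf'|f f' e _ Hf].
  - by apply: solvable_ext (solvable_mono (D := D.+1) rc (regfunC 0) ij) => d m n _; rewrite ?mul0r.
  - by apply: solvable_ext (solvableD Hf Hf') => d m n _; rewrite ?addr0.
  - by apply: solvable_ext e _ Hf.
elim: HQ => {Q} [c i j rc ij|f f' _ Hf _ Hf'|f f' e _ Hf].
- by apply: solvable_ext (solvable_mono (D := D.+1) (regfunC 0) rc ij) => d m n _; rewrite ?mul0r.
- by apply: solvable_ext (solvableD Hf Hf') => d m n _; rewrite ?addr0.
- by apply: solvable_ext _ e Hf.
Qed.

(** * Sequences of the form A M_d(k-1) + B M_d(k) *)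

Definition repr_in (D : nat) (F : nat -> nat -> nat -> rat) : Prop :=
  exists A B : nat -> nat -> nat -> rat,
    [/\ polyfun D A, polyfun D B &
      forall d m k, (0 < d)%N ->
        F d m k = A d m k * (Mshift d k)%:R + B d m k * (Mshift d k.+1)%:R].

Lemma repr_in_ext (D : nat) F G : (forall d m k, (0 < d)%N -> F d m k = G d m k) ->
  repr_in D F -> repr_in D G.
Proof. by move=> e [A [B [HA HB H]]]; exists A, B; split=> // d m k d0; rewrite -e // H. Qed.

Lemma repr_in_le (D D' : nat) F : (D <= D')%N -> repr_in D F -> repr_in D' F.
Proof. by move=> le [A [B [HA HB H]]]; exists A, B; split=> //; apply: polyfun_le le _. Qed.

Lemma repr_inD (D : nat) F G : repr_in D F -> repr_in D G ->
  repr_in D (fun d m k => F d m k + G d m k).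
Proof.
move=> [A [B [HA HB H]]] [A' [B' [HA' HB' H']]].
eexists; eexists; split; [exact: polyfunD HA HA'|exact: polyfunD HB HB'|] => d m n d0.
by rewrite H // H' //; ring.
Qed.

Lemma repr_inM (D D' : nat) f F : polyfun D f -> repr_in D' F ->
  repr_in (D + D') (fun d m k => f d m k * F d m k).
Proof.
move=> Hf [A [B [HA HB H]]].
eexists; eexists; split; [exact: polyfunM Hf HA|exact: polyfunM Hf HB|] => d m n d0.
by rewrite H //; ring.
Qed.

Lemma repr_in_sum (D : nat) (I : Type) (r : seq I) (P : pred I)
    (F : I -> nat -> nat -> nat -> rat) : (forall i, P i -> repr_in D (F i)) ->
  repr_in D (fun d m n => \sum_(i <- r | P i) F i d m n).
Proof.
move=> H; elim: r => [|i r IH].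
  exists (fun _ _ _ => 0), (fun _ _ _ => 0); split; try exact: polyfun0.
  by move=> d m n _; rewrite big_nil; ring.
case Pi: (P i); last by apply: repr_in_ext IH => d m n _; rewrite big_cons Pi.
by apply: repr_in_ext (repr_inD (H i Pi) IH) => d m n _; rewrite big_cons Pi.
Qed.

Lemma MshiftSS (d k : nat) : Mshift d k.+2 = (Mshift d k.+1 + d * Mshift d k)%N.
Proof. by []. Qed.

(** The two basis sequences start with 0, 1 and with 1, 1, which determines the coefficients from
    [Y 0] and [Y 1]. *)
Lemma recurrence_unique (d : nat) (Y : nat -> rat) :
  (forall k, Y k.+2 = Y k.+1 + d%:R * Y k) ->
  forall k, Y k = (Y 1%N - Y 0%N) * (Mshift d k)%:R + Y 0%N * (Mshift d k.+1)%:R.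
Proof.
move=> HY k; suff [] : Y k = (Y 1%N - Y 0%N) * (Mshift d k)%:R + Y 0%N * (Mshift d k.+1)%:R /\
    Y k.+1 = (Y 1%N - Y 0%N) * (Mshift d k.+1)%:R + Y 0%N * (Mshift d k.+2)%:R by [].
elim: k => [|k [IH IH1]]; first by split; rewrite /= ?muln0; ring.
by split=> //; rewrite HY IH IH1 !(MshiftSS d k.+1) (MshiftSS d k) !natrD !natrM; ring.
Qed.

(** Subtracting a particular solution [X] leaves a solution of the homogeneous recurrence; its
    coefficients are combinations of its values at 0 and 1, hence polynomials in m alone. *)
Lemma repr_in_recurrence (D : nat) (F S : nat -> nat -> nat -> rat) :
  repr_in D S -> polyfun D.+1 (fun d m _ => F d m 0%N) -> polyfun D.+1 (fun d m _ => F d m 1%N) ->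
  (forall d m k, (0 < d)%N -> F d m k.+2 = F d m k.+1 + d%:R * F d m k + S d m k) ->
  repr_in D.+1 F.
Proof.
move=> [P [Q [HP HQ HS]]] F0 F1 HF.
have [A [B [HA HB HAB]]] := polyfun_solvable HP HQ.
pose X d m k := A d m k * (Mshift d k)%:R + B d m k * (Mshift d k.+1)%:R.
(* X(0) = B(0) and X(1) = A(1) + B(1), because [Mshift d] takes the values 0, 1, 1 at 0, 1, 2. *)
have X0 : polyfun D.+1 (fun d m _ => X d m 0%N).
  apply: polyfun_ext (polyfun_subst 0 HB) => d m n _.
  by rewrite /X /=; ring.
have X1 : polyfun D.+1 (fun d m _ => X d m 1%N).
  apply: polyfun_ext (polyfunD (polyfun_subst 1 HA) (polyfun_subst 1 HB)) => d m n _.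
  by rewrite /X /= muln0; ring.
have Y0 := polyfunD F0 (polyfunN X0); have Y1 := polyfunD F1 (polyfunN X1).
eexists; eexists; split.
- exact: polyfunD HA (polyfunD Y1 (polyfunN Y0)).
- exact: polyfunD HB Y0.
move=> d m k d0; have HX l : X d m l.+2 = X d m l.+1 + d%:R * X d m l + S d m l.
  have [PE QE] := HAB d m l d0.
  by rewrite HS // PE QE /X !(MshiftSS d l.+1) (MshiftSS d l) !natrD !natrM; ring.
have /= YE := @recurrence_unique d (fun k => F d m k - X d m k) _ k.
apply: (addIr (- X d m k)); rewrite YE => [|l]; last by rewrite HX HF //; ring.
by rewrite [X d m k]/X; ring.
Qed.

(** * Moments *)

(** Telescoping (h+1)^(k+1) - h^(k+1) over h < d: its expansion in powers of h + 1 is (k+1) (h+1)^k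
    plus lower powers, whose sums are polynomials in d by induction. *)
Lemma power_sum_poly (k : nat) :
  exists S : {poly rat}, forall d : nat, \sum_(h < d) h.+1%:R ^+ k = S.[d%:R].
Proof.
elim/ltn_ind: k => k IH.
have [T HT] : exists T : {poly rat}, forall d : nat,
    \sum_(h < d) \sum_(l < k) 'C(k.+1, l)%:R * (-1) ^+ (k.+1 - l) * h.+1%:R ^+ l = T.[d%:R].
  (* Inner induction on the number of exponents, since the induction hypothesis supplies one
     polynomial for each exponent separately. *)
  have : forall N, (N <= k)%N -> exists T : {poly rat}, forall d : nat,
      \sum_(h < d) \sum_(l < N) 'C(k.+1, l)%:R * (-1) ^+ (k.+1 - l) * h.+1%:R ^+ l = T.[d%:R].
    elim=> [|N IHN] Nk.
      by exists 0 => d; rewrite horner0 big1 // => h _; rewrite big_ord0.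
    have [[T HT] [S HS]] := (IHN (ltnW Nk), IH N Nk).
    exists (T + ('C(k.+1, N)%:R * (-1) ^+ (k.+1 - N)) *: S) => d.
    rewrite hornerD hornerZ -HT -HS mulr_sumr -big_split /=.
    by apply: eq_bigr => h _; rewrite big_ord_recr.
  by apply.
exists (k.+1%:R^-1 *: ('X^(k.+1) + T)) => d.
rewrite hornerZ hornerD hornerXn -HT.
have -> : d%:R ^+ k.+1 = \sum_(h < d) (h.+1%:R ^+ k.+1 - h%:R ^+ k.+1) :> rat.
  elim: d => [|d IHd]; first by rewrite big_ord0 expr0n.
  by rewrite big_ord_recr /= -IHd addrC subrK.
rewrite -big_split mulr_sumr; apply: eq_bigr => h _ /=.
have hE : h%:R = h.+1%:R + -1 :> rat by rewrite -natr1 addrK.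
rewrite hE expr_shift.
have k0 : k.+1%:R != 0 :> rat by rewrite pnatr_eq0.
by apply: (mulfI k0); rewrite mulVKf //; ring.
Qed.

Lemma sum_poly (p : {poly rat}) :
  exists S : {poly rat}, forall d : nat, \sum_(h < d) p.[h.+1%:R] = S.[d%:R].
Proof.
suff [S HS] : exists S : {poly rat}, forall d : nat,
    \sum_(h < d) \sum_(i < size p) p`_i * h.+1%:R ^+ i = S.[d%:R].
  by exists S => d; rewrite -HS; apply: eq_bigr => h _; rewrite horner_coef.
elim: (size p) => [|N [T HT]].
  by exists 0 => d; rewrite horner0 big1 // => h _; rewrite big_ord0.
have [S HS] := power_sum_poly N; exists (T + p`_N *: S) => d.
rewrite hornerD hornerZ -HT -HS mulr_sumr -big_split /=.
by apply: eq_bigr => h _; rewrite big_ord_recr.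
Qed.

(** [e d] is the greatest height allowed in the last column: d in the recurrence, d - 1 when the
    cell (d, n) is excluded. *)
Definition poly_summable (e : nat -> nat) : Prop :=
  forall p : {poly rat}, regfun (fun d => \sum_(h < e d) p.[h.+1%:R]).

Lemma poly_summable_id : poly_summable id.
Proof.
move=> p; have [S HS] := sum_poly p.
by apply: regfun_ext (regfun_poly S) => d _; rewrite HS.
Qed.

Lemma poly_summable_pred : poly_summable predn.
Proof.
move=> p; have [S HS] := sum_poly p.
apply: regfun_ext (regfun_poly (S \Po ('X - 1))) => -[//|d] _.
by rewrite HS horner_comp !hornerE -natr1 addrK.
Qed.

Definition column_sum (e : nat -> nat) (a b d m n : nat) : rat :=
  \sum_(h < e d) (colwt m h.+1 n)%:R ^+ a * h.+1%:R ^+ b.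

(** Expanding the a-th power of [colwt] binomially gives terms of total degree exactly a in m and n,
    whose coefficients sum a polynomial in the height. The b-th power of the height only enters
    these coefficients and does not raise the degree. *)
Lemma polyfun_column_sum (e : nat -> nat) (a b : nat) :
  poly_summable e -> polyfun a (column_sum e a b).
Proof.
move=> He; pose c2 : {poly rat} := 2^-1 *: ('X * ('X - 1)).
have c2E (h : nat) : 'C(h, 2)%:R = c2.[h%:R].
  elim: h => [|h IH]; first by rewrite bin0n /c2 !hornerE ?mul0r ?mulr0.
  by rewrite binS bin1 natrD IH /c2 !hornerE -[h.+1 in RHS]addn1 natrD /=; field.
pose p i := c2 ^+ (a - i) * 'X^(i + b).
have H (i : 'I_a.+1) : true -> polyfun a (fun d m n =>
    ('C(a, i)%:R * \sum_(h < e d) (p i).[h.+1%:R]) * m%:R ^+ (a - i) * n%:R ^+ i).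
  move=> _; apply: polyfun_mono; first by apply: regfunM (regfunC _) (He _).
  by rewrite subnK // -ltnS.
apply: polyfun_ext (polyfun_sum (index_enum _) H) => d m n _.
under eq_bigr => i _ do rewrite mulr_sumr !mulr_suml.
rewrite exchange_big; apply: eq_bigr => h _ /=.
rewrite /colwt natrD !natrM exprDn mulr_suml; apply: eq_bigr => i _.
rewrite /p hornerM horner_exp hornerXn -c2E -mulr_natl !exprMn exprD; ring.
Qed.

Definition moment (a b d m k : nat) : rat :=
  nice_sum d m k (fun s c => s%:R ^+ a * c%:R ^+ b).

Lemma eq_nice_sum (d m k : nat) (phi psi : nat -> nat -> rat) :
  (forall s c, phi s c = psi s c) -> nice_sum d m k phi = nice_sum d m k psi.
Proof.
suff H l : (forall phi psi, (forall s c, phi s c = psi s c) ->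
    nice_sum d m l phi = nice_sum d m l psi /\ nice_sum d m l.+1 phi = nice_sum d m l.+1 psi).
  by move=> /(H k) [].
elim: l => [|l IH] {}phi {}psi e; first by split=> /=.
split; first exact: (IH _ _ e).2.
rewrite /= -/nice_sum; congr (_ + _); first exact: (IH _ _ e).2.
by apply: eq_bigr => h _; apply: (IH _ _ _).1.
Qed.

Lemma nice_sum_lin (d m k : nat) (I : Type) (r : seq I) (c : I -> rat)
    (phi : I -> nat -> nat -> rat) :
  nice_sum d m k (fun s t => \sum_(i <- r) c i * phi i s t) =
  \sum_(i <- r) c i * nice_sum d m k (phi i).
Proof.
suff [] : nice_sum d m k (fun s t => \sum_(i <- r) c i * phi i s t) =
    \sum_(i <- r) c i * nice_sum d m k (phi i) /\
  nice_sum d m k.+1 (fun s t => \sum_(i <- r) c i * phi i s t) =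
    \sum_(i <- r) c i * nice_sum d m k.+1 (phi i) by [].
elim: k phi => [|k IH] phi.
  by split=> //=; rewrite big1 // => i _; rewrite mulr0.
split; first exact: (IH phi).2.
transitivity (\sum_(i <- r) c i * nice_sum d m k.+1 (phi i) + \sum_(h < d) \sum_(i <- r) c i *
    nice_sum d m k (fun s t => phi i (s + colwt m h.+1 k)%N (t + h.+1)%N)).
  rewrite -(IH phi).2 /=; congr (_ + _); apply: eq_bigr => h _.
  exact: (IH (fun i s t => phi i (s + colwt m h.+1 k)%N (t + h.+1)%N)).1.
rewrite exchange_big -big_split /=; apply: eq_bigr => i _.
by rewrite mulrDr mulr_sumr.
Qed.

(** Both powers are expanded binomially: the part depending on the last column sums over [h] to a
    [column_sum], and the rest is a moment with exponents [p.1] and [p.2]. *)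
Lemma moment_shift (e : nat -> nat) (a b d m k : nat) :
  \sum_(h < e d) nice_sum d m k
     (fun s c => (s + colwt m h.+1 k)%:R ^+ a * (c + h.+1)%:R ^+ b) =
  \sum_(p : 'I_a.+1 * 'I_b.+1) ('C(a, p.1) * 'C(b, p.2))%:R *
     (column_sum e (a - p.1) (b - p.2) d m k * moment p.1 p.2 d m k).
Proof.
under [RHS]eq_bigr => p _ do rewrite mulr_suml mulr_sumr.
rewrite exchange_big; apply: eq_bigr => h _ /=.
pose w := colwt m h.+1 k.
pose c (p : 'I_a.+1 * 'I_b.+1) : rat := ('C(a, p.1) * 'C(b, p.2))%:R *
  (w%:R ^+ (a - p.1) * h.+1%:R ^+ (b - p.2)).
rewrite (@eq_nice_sum _ _ _ _ (fun s t => \sum_p c p * (s%:R ^+ p.1 * t%:R ^+ p.2))).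
  by rewrite nice_sum_lin; apply: eq_bigr => p _; rewrite /c /moment -!mulrA.
move=> s t; rewrite (addnC s) (addnC t) (natrD _ _ s) (natrD _ _ t) !exprDn mulr_suml.
rewrite (eq_bigr (fun i : 'I_a.+1 => \sum_(j < b.+1) c (i, j) * (s%:R ^+ i * t%:R ^+ j))).
  by rewrite pair_bigA /=; apply: eq_bigr => -[].
move=> i _; rewrite mulr_sumr; apply: eq_bigr => j _.
by rewrite /c /w natrM -[_ *+ 'C(a, i)]mulr_natl -[_ *+ 'C(b, j)]mulr_natl /=; ring.
Qed.

(** With both exponents 0 every nice set counts for 1, and the recurrence and initial values are
    those of M_d. *)
Lemma moment00 (d m k : nat) : moment 0 0 d m k = (Mshift d k)%:R.
Proof.
have H l : moment 0 0 d m l.+2 = moment 0 0 d m l.+1 + d%:R * moment 0 0 d m l.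
  transitivity (moment 0 0 d m l.+1 + \sum_(h < d) moment 0 0 d m l) => //.
  by rewrite sumr_const card_ord mulr_natl.
rewrite (recurrence_unique H) /moment /= mulr1; ring.
Qed.

(** Induction on a + b. In the expanded recurrence the [top] term is d times the same moment; the
    term (i, j) has degree at most (a - i) + (2i + j) = a + i + j, which is below 2a + b because i +
    j < a + b. Solving the recurrence then costs one degree. *)
Lemma repr_in_moment (a b : nat) : repr_in (2 * a + b) (moment a b).
Proof.
have [N] := ubnP (a + b); elim: N a b => // N IH a b abN.
pose top : 'I_a.+1 * 'I_b.+1 := (ord_max, ord_max).
pose S d m k : rat := \sum_(p : 'I_a.+1 * 'I_b.+1 | p != top) ('C(a, p.1) * 'C(b, p.2))%:R *
     (column_sum id (a - p.1) (b - p.2) d m k * moment p.1 p.2 d m k).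
have rec d m k : (0 < d)%N -> moment a b d m k.+2 =
    moment a b d m k.+1 + d%:R * moment a b d m k + S d m k.
  move=> _; rewrite -addrA; congr (_ + _).
  rewrite -[LHS]/(\sum_(h < d) _) (moment_shift id) (bigD1 top) //=; congr (_ + _).
  rewrite !binn mul1r !subnn; congr (_ * _).
  by rewrite /column_sum; under eq_bigr do rewrite mulr1; rewrite sumr_const card_ord.
have lt_top (p : 'I_a.+1 * 'I_b.+1) : p != top -> (p.1 + p.2 < a + b)%N.
  case: p => i j; rewrite xpair_eqE -!(inj_eq val_inj) /= => ij.
  by have := ltn_ord i; have := ltn_ord j; lia.
have rS D : (2 * a + b <= D.+1)%N -> repr_in D S.
  move=> abD; apply: repr_in_sum => -[i j] /lt_top /= ijab.
  have ijN : (i + j < N)%N by apply: leq_trans ijab _; rewrite -ltnS.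
  have ri := repr_inM (polyfun_column_sum (a - i) (b - j) poly_summable_id) (IH _ _ ijN).
  have := repr_inM (polyfun_reg (regfunC ('C(a, i) * 'C(b, j))%:R)) ri.
  rewrite add0n; apply: repr_in_le.
  by have := ltn_ord i; lia.
have m1E (d m : nat) : moment a b d m 1 = 0%:R ^+ a * 0%:R ^+ b by [].
(* For 2a + b = 0 no smaller degree is available, but the moment is then [Mshift d k] itself. *)
case abE: (2 * a + b)%N => [|D].
  have [a0 b0] : a = 0%N /\ b = 0%N.
    by move/eqP: abE; rewrite addn_eq0 muln_eq0 /= => /andP[/eqP -> /eqP ->].
  rewrite a0 b0; exists (fun _ _ _ => 1), (fun _ _ _ => 0).
  split; [exact: polyfun_reg (regfunC 1)|exact: polyfun0|] => d m k _.
  by rewrite moment00 mul1r mul0r addr0.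
apply: (repr_in_recurrence (S := S)); first by apply: rS; rewrite abE.
- by apply: polyfun_ext (polyfun0 _) => d m n _.
- apply: polyfun_ext (polyfun_le (leq0n _) (polyfun_reg (regfunC (0%:R ^+ a * 0%:R ^+ b)))).
  by move=> d m n _; rewrite m1E.
- exact: rec.
Qed.

Lemma repr_in_Gminus (a b : nat) : exists A B : nat -> nat -> nat -> rat,
  [/\ polyfun (2 * a + b) A, polyfun (2 * a + b) B &
    forall d m n, (0 < d)%N ->
      (Gminus d m a b n)%:R = A d m n * (Md d n)%:R + B d m n * (Md d n.+1)%:R].
Proof.
have [A [B [HA HB HAB]]] := repr_in_moment a b.
have [A' [B' [HA' HB' HAB']]] : repr_in (2 * a + b) (fun d m k =>
    \sum_(p : 'I_a.+1 * 'I_b.+1) ('C(a, p.1) * 'C(b, p.2))%:R *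
     (column_sum predn (a - p.1) (b - p.2) d m k * moment p.1 p.2 d m k)).
  apply: repr_in_sum => -[i j] _ /=.
  have ri := repr_inM (polyfun_column_sum (a - i) (b - j) poly_summable_pred) (repr_in_moment i j).
  have := repr_inM (polyfun_reg (regfunC ('C(a, i) * 'C(b, j))%:R)) ri.
  rewrite add0n; apply: repr_in_le.
  by have := ltn_ord i; have := ltn_ord j; lia.
have rdV : regfun (fun d => d%:R^-1).
  by apply: regfunV regfun_id => d; rewrite pnatr_eq0 -lt0n.
(* The moment at index n + 1 already involves M_d(n) and M_d(n+1). The other sum, at index n,
   involves M_d(n-1), eliminated through M_d(n-1) = (M_d(n+1) - M_d(n)) / d. *)
exists (fun d m n => A d m n.+1 + (B' d m n - d%:R^-1 * A' d m n)).
exists (fun d m n => B d m n.+1 + d%:R^-1 * A' d m n).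
split=> [||d m n d0].
- apply: polyfunD (polyfun_shift HA) (polyfunD HB' (polyfunN (polyfunZ rdV HA'))).
- exact: polyfunD (polyfun_shift HB) (polyfunZ rdV HA').
rewrite GminusE // -[nice_sum d m n.+1 _]/(moment a b d m n.+1) HAB // (moment_shift predn) HAB' //.
have dn0 : d%:R != 0 :> rat by rewrite pnatr_eq0 -lt0n.
by rewrite /Md (MshiftSS d n) natrD natrM; field.
Qed.

(** * Conversion to polynomials over Q(d) *)

Lemma rf_fracE (f : ratfun) : rf_den f != 0 /\
  f = FracField.tofrac (rf_num f) / FracField.tofrac (rf_den f).
Proof.
have w0 : \d_(repr f) != 0 by exact: denom_ratioP.
have fE : f = FracField.tofrac \n_(repr f) / FracField.tofrac \d_(repr f).
  have W0 : FracField.tofrac \d_(repr f) != 0 by rewrite tofrac_eq0.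
  apply: (mulIf W0); rewrite divfK // -{1}[f]reprK !piE; apply/eqP.
  rewrite -[_ == _]/(_ == _) piE /= /FracField.equivf.
  by rewrite /FracField.mulf !numden_Ratio ?oner_eq0 ?mulr1 // mulrC.
have [k pE qE] := rf_numden w0 fE.
move: w0; rewrite {1}qE mulf_eq0 negb_or => /andP[den0 k0]; split=> //.
by rewrite {1}fE {1}pE {1}qE !tofracM -mulf_div divff ?mulr1 // tofrac_eq0.
Qed.

(** [rf_eval] may be computed from any fraction whose denominator does not vanish at [x], in
    particular from the cross-multiplied one. At poles additivity can fail. *)
Lemma rf_evalD (f g : ratfun) (x : rat) : rf_regular f x -> rf_regular g x ->
  rf_regular (f + g) x /\ rf_eval x (f + g) = rf_eval x f + rf_eval x g.
Proof.
move=> rf rg; have [f0 fE] := rf_fracE f; have [g0 gE] := rf_fracE g.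
have fgE : f + g = FracField.tofrac (rf_num f * rf_den g + rf_num g * rf_den f) /
                   FracField.tofrac (rf_den f * rf_den g).
  by rewrite {1}fE {1}gE addf_div ?tofrac_eq0 // tofracD !tofracM.
have fgx : (rf_den f * rf_den g).[x] != 0 by rewrite hornerM mulf_neq0.
by have [-> ->] := rf_evalE fgx fgE; split=> //; rewrite /rf_eval !(hornerM, hornerD) addf_div.
Qed.

Lemma rf_eval0 (x : rat) : rf_regular 0 x /\ rf_eval x 0 = 0.
Proof.
have x0 : (1 : {poly rat}).[x] != 0 by rewrite hornerC oner_eq0.
have [|-> ->] := @rf_evalE 0 0 1 x x0; first by rewrite tofrac0 mul0r.
by rewrite horner0 mul0r.
Qed.

Definition mn_point (m n : nat) (i : 'I_2) : rat :=
  if i == 0%N :> nat then m%:R else n%:R.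

(** Summing over all monomials of degree below [N], rather than over the support, gives two
    polynomials and their sum a common index set; the extra terms vanish because [rf_eval] sends 0
    to 0. *)
Lemma mn_evalE (P : {mpoly ratfun[2]}) (N m n d : nat) : (msize P <= N)%N ->
  mn_eval P m n d =
    \sum_(u : 'X_{1..2 < N}) rf_eval d%:R P@_u * mmap1 (mn_point m n) u.
Proof.
move=> PN; rewrite /mn_eval /mmap; set I : subFinType _ := 'X_{1..2 < N}.
rewrite (big_mksub I) ?msupp_uniq //=; first last.
  by move=> u /msize_mdeg_lt /leq_trans; apply.
rewrite big_rmcond //= => u /memN_msupp_eq0 ->.
by rewrite (rf_eval0 _).2 mul0r.
Qed.

(** Regularity of the coefficients is carried through the induction because it is what makes
    evaluation additive. *)
Lemma polyfun_mpoly (D : nat) f : polyfun D f ->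
  exists2 P : {mpoly ratfun[2]}, (msize P <= D.+1)%N &
    forall d m n, (0 < d)%N -> coefs_regular P d /\ mn_eval P m n d = f d m n.
Proof.
elim=> {f} [c i j [p [q H]] ij|f g _ [P sP HP] _ [Q sQ HQ]|f g e _ [P sP HP]]; last first.
- by exists P => // d m n d0; rewrite -e //; apply: HP.
- exists (P + Q); first by rewrite (leq_trans (msizeD_le _ _)) // geq_max sP.
  move=> d m n d0; have [[rP eP] [rQ eQ]] := (HP d m n d0, HQ d m n d0).
  have PQ u := rf_evalD (rP u) (rQ u).
  split=> [u|]; first by rewrite mcoeffD; apply: (PQ u).1.
  rewrite (@mn_evalE _ D.+1); last by rewrite (leq_trans (msizeD_le _ _)) // geq_max sP.
  rewrite -eP -eQ !(@mn_evalE _ D.+1) // -big_split; apply: eq_bigr => u _ /=.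
  by rewrite mcoeffD (PQ u).2 mulrDl.
pose r : ratfun := FracField.tofrac p / FracField.tofrac q.
(* [ord0] is the variable m and [ord_max] the variable n. *)
pose u : 'X_{1..2} := (U_(ord0) *+ i + U_(ord_max) *+ j)%MM.
have u_deg : mdeg u = (i + j)%N by rewrite mdegD !mdegMn !mdeg1 !mul1n.
have size_le : (msize (r *: 'X_[u]) <= D.+1)%N.
  by rewrite (leq_trans (msizeZ_le _ _)) // msizeX u_deg.
exists (r *: 'X_[u]) => // d m n d0.
have [q0 cE] := H d d0; have [rr er] := rf_evalE q0 (erefl r).
have coefE v : (r *: 'X_[u])@_v = if v == u then r else 0.
  by rewrite mcoeffZ mcoeffX eq_sym; case: eqP; rewrite ?mulr1 ?mulr0.
split=> [v|]; first by rewrite coefE; case: eqP => // _; exact: (rf_eval0 _).1.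
have u_lt : (mdeg u < D.+1)%N by rewrite u_deg.
rewrite (mn_evalE _ _ _ size_le) (bigD1 (BMultinom u_lt)) //= coefE eqxx er -cE.
rewrite big1 ?addr0 => [|v vu]; last first.
  by rewrite coefE -[X in _ == X]/(val (BMultinom u_lt)) val_eqE (negPf vu) (rf_eval0 _).2 mul0r.
rewrite -mulrA; congr (_ * _).
by rewrite /mmap1 big_ord_recl big_ord1 !mnmDE !mulmnE !mnm1E /= !mul1n !mul0n addn0.
Qed.

Theorem theorem4p6 (a b : nat) :
  exists A B : {mpoly ratfun[2]},
    [/\ (msize A <= (2 * a + b).+1)%N,
        (msize B <= (2 * a + b).+1)%N &
        forall d m n : nat, (1 <= d)%N ->
          [/\ coefs_regular A d, coefs_regular B d &
              (Gminus d m a b n)%:R =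
                mn_eval A m n d * (Md d n)%:R
                + mn_eval B m n d * (Md d n.+1)%:R :> rat]].
Proof.
have [f [g [/polyfun_mpoly [A sA HA] /polyfun_mpoly [B sB HB] H]]] := repr_in_Gminus a b.
exists A, B; split=> // d m n d0.
have [[rA eA] [rB eB]] := (HA d m n d0, HB d m n d0).
by split=> //; rewrite eA eB; apply: H.
Qed.
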